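(* Let $R$ be a commutative ring with unit, let $q\in R$ be such that $R$ is $q$-torsion free and $qR$ is a prime ideal of $R$, and let $n\geq 2$ and $d\geq 1$ be integers. Then the set $$\widetilde{A}_d(n,R,q)=\{\psi\in \mathrm{Aut}(\mathbb{A}^1_{R/q^{n}}) : \deg(\psi \bmod q^m)\leq 2^{m-2}d \text{ for all } 2\leq m\leq n\}$$ is a subgroup of $\mathrm{Aut}(\mathbb{A}^1_{R/q^n})$.
   Context: For a commutative ring $B$, $\mathrm{Aut}(\mathbb{A}^1_B)$ denotes the group of polynomials $f\in B[T]$ that are invertible under composition (equivalently, $T\mapsto f(T)$ defines a $B$-algebra automorphism of $B[T]$), with group law composition of polynomials. For $\psi\in (R/q^n)[T]$ and $m\leq n$, $\psi\bmod q^m$ denotes the image of $\psi$ in $(R/q^m)[T]$, and $\deg$ is its degree there. *)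

(* Defs.v *)
From HB Require Import structures.
From mathcomp Require Import all_boot all_order all_algebra.
From mathcomp Require Import boolp.

Set Implicit Arguments.
Unset Strict Implicit.
Unset Printing Implicit Defensive.

Import GRing.Theory.
Local Open Scope ring_scope.
Local Open Scope quotient_scope.

Section CompositionAutomorphisms.

Variable B : comNzRingType.
Implicit Types f g : {poly B}.

Definition comp_invertible : pred {poly B} :=
  fun f => `[< exists g, f \Po g = 'X /\ g \Po f = 'X >].

(* The group Aut(A^1_B), with product f * g := f \Po g, i.e. f(g(T)). *)
Definition autA1 := {f : {poly B} | comp_invertible f}.

HB.instance Definition _ := SubChoice.on autA1.

Lemma comp_invertibleX : comp_invertible 'X.
Proof. by apply/asboolP; exists 'X; rewrite comp_polyX. Qed.

Lemma comp_invertible_comp (f g : autA1) : comp_invertible (val f \Po val g).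
Proof.
case: f g => [f /= /asboolP[f' [ff' f'f]]] [g /= /asboolP[g' [gg' g'g]]].
apply/asboolP; exists (g' \Po f'); split.
  by rewrite -comp_polyA [g \Po _]comp_polyA gg' comp_polyX.
by rewrite -comp_polyA [f' \Po _]comp_polyA f'f comp_polyX.
Qed.

Lemma comp_inverse_ex (f : autA1) :
  exists g : autA1, val f \Po val g = 'X /\ val g \Po val f = 'X.
Proof.
case: f => [f /= /asboolP[g [fg gf]]].
have gP : comp_invertible g by apply/asboolP; exists f.
by exists (exist _ g gP).
Qed.

Definition autA1_one : autA1 := exist _ 'X comp_invertibleX.
Definition autA1_mul (f g : autA1) : autA1 :=
  exist _ (val f \Po val g) (comp_invertible_comp f g).
Definition autA1_inv (f : autA1) : autA1 := projT1 (cid (comp_inverse_ex f)).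

Fact autA1_mulA : associative autA1_mul.
Proof. by move=> f g h; apply: val_inj; rewrite /= comp_polyA. Qed.

Fact autA1_mul1 : left_id autA1_one autA1_mul.
Proof. by move=> f; apply: val_inj; rewrite /= comp_polyX. Qed.

Fact autA1_mulr1 : right_id autA1_one autA1_mul.
Proof. by move=> f; apply: val_inj; rewrite /= comp_polyXr. Qed.

Fact autA1_mulV : left_inverse autA1_one autA1_inv autA1_mul.
Proof.
by move=> f; apply: val_inj; rewrite /= /autA1_inv; case: cid => g [].
Qed.

Fact autA1_mulrV : right_inverse autA1_one autA1_inv autA1_mul.
Proof.
by move=> f; apply: val_inj; rewrite /= /autA1_inv; case: cid => g [].
Qed.

HB.instance Definition _ := isGroup.Build autA1
  autA1_mulA autA1_mul1 autA1_mulr1 autA1_mulV autA1_mulrV.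

End CompositionAutomorphisms.

Section PowerQuotients.

Variable R : comNzRingType.

Definition principal (a : R) : {pred R} :=
  fun x => `[< exists y, x = a * y >].

(* [idealr_closed] includes properness, i.e. 1 \notin I. *)
Definition is_prime_ideal (I : {pred R}) : Prop :=
  idealr_closed I /\ prime_idealr_closed I.

Variables (q : R) (q_prime : is_prime_ideal (principal q)).

Fact qpow_idealr_closed m : (0 < m)%N -> idealr_closed (principal (q ^+ m)).
Proof.
case: q_prime => [[_ q1 _] _] m_gt0; split.
- by apply/asboolP; exists 0; rewrite mulr0.
- apply: contra q1 => /asboolP[y y1]; apply/asboolP.
  by exists (q ^+ m.-1 * y); rewrite y1 mulrA -exprS prednK.
- move=> a u v /asboolP[y ->] /asboolP[z ->]; apply/asboolP.
  by exists (a * y + z); rewrite mulrDr mulrCA.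
Qed.

(* The ideal q^m R; m > 0 makes it proper, so that R/q^m is nonzero, as
   {poly R/q^m} requires. *)
Definition qpow m (m_gt0 : (0 < m)%N) : idealr R :=
  HB.pack (principal (q ^+ m) : R -> bool)
    (isIdealr.Build R (principal (q ^+ m)) (qpow_idealr_closed m_gt0)).

(* The canonical map R/q^n -> R/q^m; see [qredE]. *)
Definition qred m n (m_gt0 : (0 < m)%N) (n_gt0 : (0 < n)%N) (le_mn : (m <= n)%N)
    (x : {ideal_quot (qpow n_gt0)}) : {ideal_quot (qpow m_gt0)} :=
  \pi_{ideal_quot (qpow m_gt0)} (repr x).

Section Reduction.

Variables (m n : nat) (m_gt0 : (0 < m)%N) (n_gt0 : (0 < n)%N).
Variable le_mn : (m <= n)%N.

Lemma qredE (x : R) :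
  qred m_gt0 le_mn (\pi_{ideal_quot (qpow n_gt0)} x) =
  \pi_{ideal_quot (qpow m_gt0)} x.
Proof.
rewrite /qred; apply/eqP; rewrite -Quotient.idealrBE.
have : repr (\pi_{ideal_quot (qpow n_gt0)} x) - x \in qpow n_gt0.
  by rewrite Quotient.idealrBE reprK.
move=> /asboolP[y ->]; apply/asboolP; exists (q ^+ (n - m) * y).
by rewrite mulrA -exprD subnKC.
Qed.

Fact qred_zmod_morphism : zmod_morphism (@qred m n m_gt0 n_gt0 le_mn).
Proof.
by move=> x y; rewrite -[x]reprK -[y]reprK -rmorphB /= !qredE rmorphB.
Qed.

Fact qred_monoid_morphism : monoid_morphism (@qred m n m_gt0 n_gt0 le_mn).
Proof.
split; first by rewrite -(rmorph1 (\pi_{ideal_quot (qpow n_gt0)})) qredE rmorph1.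
by move=> x y; rewrite -[x]reprK -[y]reprK -rmorphM /= !qredE rmorphM.
Qed.

HB.instance Definition _ := GRing.isZmodMorphism.Build _ _
  (@qred m n m_gt0 n_gt0 le_mn) qred_zmod_morphism.
HB.instance Definition _ := GRing.isMonoidMorphism.Build _ _
  (@qred m n m_gt0 n_gt0 le_mn) qred_monoid_morphism.

End Reduction.

Definition deg (A : nzSemiRingType) (p : {poly A}) : nat := (size p).-1.

Definition Atilde (n d : nat) (n_ge2 : (2 <= n)%N) :
    {pred autA1 {ideal_quot (qpow (ltnW n_ge2))}} :=
  fun psi => `[< forall (m : nat) (m_ge2 : (2 <= m)%N) (le_mn : (m <= n)%N),
    (deg (map_poly (qred (ltnW m_ge2) le_mn) (val psi)) <= 2 ^ (m - 2) * d)%N >].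

End PowerQuotients.

Arguments Atilde {R q} q_prime n d n_ge2.

(* Main.v *)
Require Import Defs.
From mathcomp Require Import all_boot all_order all_algebra.
From mathcomp Require Import boolp zify.

(** For a polynomial [p] over a ring with a distinguished element [q], record
    for each [s] a bound on the degree of [p] modulo [q ^ s.+1].  Automorphisms
    over [R/q^n] are affine modulo [q], so membership in [Atilde] reads: the
    degree modulo [q ^ s.+1] is at most [e s := maxn 1 (excess d s)], with
    [excess d 0 = 0] and [excess d s = 2^(s-1) d].  As [excess] is
    superadditive, [g ^+ i] has degree at most [i + excess d s] modulo
    [q ^ s.+1].  A coefficient [f`_i] with [e (t-1) < i <= e t] is divisible by
    [q ^ t], and [i + excess d (s - t) <= e s] for [i >= 2]; this gives
    stability under composition.  Moreover the nonlinear part of [f] is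
    divisible by [q], so the nonlinear part of [f \Po g] modulo [q ^ m.+1] only
    depends on [g] modulo [q ^ m]: solving [f \Po g = 'X] for the linear term
    [f`_1 *: g], with [f`_1] a unit, bounds [g] by induction on [m]. *)

Set Implicit Arguments.
Unset Strict Implicit.
Unset Printing Implicit Defensive.

Import GRing.Theory.
Local Open Scope ring_scope.
Local Open Scope quotient_scope.

(** * Divisibility by a fixed element *)

Section Principal.

Variable A : comNzRingType.
Implicit Types a b x y : A.

Lemma principal0 a : 0 \in principal a.
Proof. by apply/asboolP; exists 0; rewrite mulr0. Qed.

Lemma principalD a x y :
  x \in principal a -> y \in principal a -> x + y \in principal a.
Proof.
by move=> /asboolP[u ->] /asboolP[v ->]; apply/asboolP; exists (u + v);
  rewrite mulrDr.
Qed.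

Lemma principalMl a x y : y \in principal a -> x * y \in principal a.
Proof.
by move=> /asboolP[u ->]; apply/asboolP; exists (x * u); rewrite mulrCA.
Qed.

Lemma principalMr a x y : x \in principal a -> x * y \in principal a.
Proof. by rewrite mulrC; apply: principalMl. Qed.

Lemma principalM a b x y :
  x \in principal a -> y \in principal b -> x * y \in principal (a * b).
Proof.
move=> /asboolP[u ->] /asboolP[v ->]; apply/asboolP; exists (u * v).
by rewrite mulrACA.
Qed.

Lemma principal_sum a (I : finType) (F : I -> A) :
  (forall i, F i \in principal a) -> \sum_i F i \in principal a.
Proof.
move=> Fa; elim/big_ind: _ => //; first exact: principal0.
by move=> x y; apply: principalD.
Qed.

End Principal.

(** * Degree bounds modulo powers of [q], under products, composition and inversion *)

Section DegreeBounds.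

Variables (A : comNzRingType) (q : A).
Implicit Types (b : nat -> nat) (p f g : {poly A}).

Definition deg_bounded b m p :=
  forall s, (s < m)%N -> forall j, (b s < j)%N -> p`_j \in principal (q ^+ s.+1).

Lemma deg_boundedS b m p : deg_bounded b m.+1 p -> deg_bounded b m p.
Proof. by move=> bp s lt_sm; apply: bp; apply: ltnW. Qed.

Lemma deg_boundedD b m p f :
  deg_bounded b m p -> deg_bounded b m f -> deg_bounded b m (p + f).
Proof.
move=> bp bf s ltsm j jb; rewrite coefD.
by apply: principalD; [apply: bp | apply: bf].
Qed.

Lemma deg_boundedZ b m (a : A) p : deg_bounded b m p -> deg_bounded b m (a *: p).
Proof. by move=> bp s ltsm j jb; rewrite coefZ; apply/principalMl/bp. Qed.

Lemma deg_boundedN b m p : deg_bounded b m p -> deg_bounded b m (- p).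
Proof. by rewrite -scaleN1r; apply: deg_boundedZ. Qed.

Lemma deg_bounded_sum b m (I : finType) (F : I -> {poly A}) :
  (forall i, deg_bounded b m (F i)) -> deg_bounded b m (\sum_i F i).
Proof.
move=> bF s ltsm j jb; rewrite coef_sum; apply: principal_sum => i.
exact: bF.
Qed.

Lemma deg_bounded_size b m p :
  (forall s, (size p <= (b s).+1)%N) -> deg_bounded b m p.
Proof.
move=> szp s _ j jb; rewrite nth_default ?principal0 //.
exact: leq_trans (szp s) jb.
Qed.

(** In the second case [t] is the least level whose bound reaches [j]; the level just below it gives
    divisibility by [q ^+ t]. *)
Lemma deg_bounded_coef b m p s j : deg_bounded b m p -> (s < m)%N ->
  p`_j \in principal (q ^+ s.+1) \/
  exists t, [/\ (t <= s)%N, (j <= b t)%N & p`_j \in principal (q ^+ t)].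
Proof.
move=> bp; elim: s => [|s IHs] ltsm.
  case: (leqP j (b 0%N)) => jb; last by left; apply: bp.
  by right; exists 0%N; split=> //; apply/asboolP; exists p`_j; rewrite mul1r.
have [|[t [lets jt pt]]] := IHs (ltnW ltsm); last first.
  by right; exists t; split=> //; apply: leqW.
case: (leqP j (b s.+1)) => jb pj; last by left; apply: bp.
by right; exists s.+1.
Qed.

(** A coefficient of [p] divisible by [q ^+ t] leaves only [q ^+ (s - t).+1] to be supplied by [f],
    hence its bound at level [s - t]. *)
Lemma deg_boundedM b b' c m p f :
    (forall s t, (t <= s)%N -> (b t + b' (s - t) <= c s)%N) ->
  deg_bounded b m p -> deg_bounded b' m f -> deg_bounded c m (p * f).
Proof.
move=> bb'c bp bf s ltsm j jc; rewrite coefM; apply: principal_sum => i.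
have [pi|[t [lets it pt]]] := deg_bounded_coef i bp ltsm.
  exact: principalMr.
have -> : s.+1 = (t + (s - t).+1)%N by lia.
rewrite exprD; apply: principalM => //; apply: bf; first by lia.
by have := bb'c s t lets; have := ltn_ord i; lia.
Qed.

Definition excess d s := if s is s'.+1 then (2 ^ s' * d)%N else 0%N.

Lemma excessD d s t : (excess d s + excess d t <= excess d (s + t))%N.
Proof.
case: s t => [|s] [|t]; rewrite ?addn0 //= -mulnDl leq_mul2r; apply/orP; right.
rewrite addnS expnS expnD.
by have := expn_gt0 2 s; have := expn_gt0 2 t; nia.
Qed.

Definition slope d s := maxn 1 (excess d s).

Lemma deg_bounded_slopeX d m : deg_bounded (slope d) m 'X.
Proof. by apply: deg_bounded_size => s; rewrite size_polyX ltnS leq_maxl. Qed.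

(** As [slope d s <= 1 + excess d s], each factor adds 1 to the degree, and superadditivity absorbs
    the excesses. *)
Lemma deg_bounded_exp d m g i : deg_bounded (slope d) m g ->
  deg_bounded (fun s => i + excess d s)%N m (g ^+ i).
Proof.
move=> bg; elim: i => [|i IHi].
  by apply: deg_bounded_size => s; rewrite expr0 size_poly1.
rewrite exprS; apply: deg_boundedM bg IHi => s t lets.
by have := excessD d t (s - t); rewrite subnKC // /slope; lia.
Qed.

(* One more level than known for [g] is gained because the nonlinear
   coefficients of [f] are divisible by [q]. *)
Lemma deg_bounded_comp_nonlinear d m f g : f`_1 = 0 ->
    deg_bounded (slope d) m.+1 f -> deg_bounded (slope d) m g ->
  deg_bounded (slope d) m.+1 (f \Po g).
Proof.
move=> f1 bf bg; rewrite comp_polyE; apply: deg_bounded_sum => -[[|[|i]] /= _].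
- by apply: deg_boundedZ; apply: deg_bounded_size => s; rewrite size_poly1.
- by rewrite f1 scale0r; apply: deg_bounded_size => s; rewrite size_poly0.
move=> s ltsm j js; rewrite coefZ.
have [pi|[[|t] [lets it pt]]] := deg_bounded_coef i.+2 bf ltsm.
- exact: principalMr.
(* Level 0 is impossible: [slope d 0] is 1, below [i.+2]. *)
- by [].
(* Since [i.+2 > 1], the slope bounding it is [excess d t.+1], so superadditivity applies. As
   [t.+1 > 0], [g] is only used at levels below [m]. *)
have -> : s.+1 = (t.+1 + (s - t.+1).+1)%N by lia.
rewrite exprD; apply: principalM => //; apply: (deg_bounded_exp bg); first by lia.
have := excessD d t.+1 (s - t.+1); rewrite subnKC //.
by move: js it; rewrite /slope; lia.
Qed.

(** The constant term is kept: it composes to a constant, which meets every bound. *)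
Definition nonlinear f := f - f`_1 *: 'X.

Lemma nonlinear_coef f i :
  (nonlinear f)`_i = if i == 1%N then 0 else f`_i.
Proof.
rewrite coefB coefZ coefX; case: eqP => [->|_]; first by rewrite mulr1 subrr.
by rewrite mulr0 subr0.
Qed.

Lemma nonlinear_comp f g : f \Po g = nonlinear f \Po g + f`_1 *: g.
Proof.
rewrite -[X in _ + _ *: X](comp_polyX g) -comp_polyZ -comp_polyD.
by rewrite subrK.
Qed.

Lemma deg_bounded_nonlinear d m f :
  deg_bounded (slope d) m f -> deg_bounded (slope d) m (nonlinear f).
Proof.
move=> bf; apply/deg_boundedD/deg_boundedN/deg_boundedZ => //.
exact: deg_bounded_slopeX.
Qed.

Lemma deg_bounded_comp d m f g :
    deg_bounded (slope d) m f -> deg_bounded (slope d) m g ->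
  deg_bounded (slope d) m (f \Po g).
Proof.
case: m => [|m] bf bg; first by [].
rewrite nonlinear_comp; apply/deg_boundedD/deg_boundedZ => //.
apply: deg_bounded_comp_nonlinear; first by rewrite nonlinear_coef.
  exact: deg_bounded_nonlinear.
exact: deg_boundedS.
Qed.

(** Modulo [q] only the linear term of [f] contributes to the coefficient of ['X] in [f \Po g], so
    [f]_1 * g[_1] is 1 modulo a nilpotent. *)
Lemma comp_inverse_linear_unit n d f g : q ^+ n = 0 -> f \Po g = 'X ->
  deg_bounded (slope d) 1 f -> exists u, u * f`_1 = 1.
Proof.
move=> qn0 fg bf.
have : (nonlinear f \Po g)`_1 \in principal q.
  rewrite coef_comp_poly; apply: principal_sum => -[i _] /=.
  rewrite nonlinear_coef; case: i => [|[|i]] /=.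
  - by rewrite coef1 mulr0 principal0.
  - by rewrite mul0r principal0.
  by rewrite -[q]expr1; apply/principalMr/bf.
move=> /asboolP[y hy].
have f1g1 : f`_1 * g`_1 = 1 - q * y.
  have := congr1 (fun p : {poly A} => p`_1) fg.
  by rewrite nonlinear_comp coefD coefZ coefX hy => /(canRL (addKr _)) ->; rewrite addrC.
(* The truncated geometric series inverts [1 - q * y]. *)
exists (g`_1 * \sum_(i < n) (q * y) ^+ i).
rewrite mulrAC [g`_1 * _]mulrC f1g1 -opprB mulNr -subrX1 exprMn qn0 mul0r.
by rewrite sub0r opprK.
Qed.

Lemma deg_bounded_inverse n d f g : q ^+ n = 0 -> f \Po g = 'X ->
    deg_bounded (slope d) n f -> deg_bounded (slope d) 1 g ->
  deg_bounded (slope d) n g.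
Proof.
case: n => [//|n] qn0 fg bf bg.
have [u uf1] : exists u, u * f`_1 = 1.
  by apply: comp_inverse_linear_unit qn0 fg _ => s ltsm; apply: bf; lia.
have eg : g = u *: ('X - (nonlinear f \Po g)).
  rewrite -fg (nonlinear_comp f g) [_ + f`_1 *: g]addrC addrK.
  by rewrite scalerA uf1 scale1r.
suff bgm m : (m <= n)%N -> deg_bounded (slope d) m.+1 g by apply: bgm.
elim: m => [//|m IHm] ltmn; rewrite eg.
apply/deg_boundedZ/deg_boundedD/deg_boundedN; first exact: deg_bounded_slopeX.
apply: deg_bounded_comp_nonlinear (IHm (ltnW ltmn)).
  by rewrite nonlinear_coef.
by apply: deg_bounded_nonlinear => s ltsm; apply: bf; lia.
Qed.

End DegreeBounds.

(** * Polynomials invertible under composition over a domain *)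

Section CompositionInverseDomain.

Variable B : comNzRingType.
Hypothesis domB : forall x y : B, x * y = 0 -> (x == 0) || (y == 0).
Implicit Types f g : {poly B}.

Lemma domain_expf_neq0 (x : B) k : x != 0 -> x ^+ k != 0.
Proof.
move=> x0; elim: k => [|k IHk]; first by rewrite expr0 oner_neq0.
by apply/eqP; rewrite exprS => /domB; rewrite (negPf x0) (negPf IHk).
Qed.

Lemma coef_exp_deg f k : (f ^+ k)`_((size f).-1 * k) = lead_coef f ^+ k.
Proof.
have [->|f0] := eqVneq f 0.
  by case: k => [|k]; rewrite ?expr0 ?size_poly0 ?muln0 ?coef1 // !exprS !mul0r
    lead_coef0 mul0r coef0.
elim: k => [|k IHk]; first by rewrite muln0 !expr0 coef1.
(* Only the product of the two top coefficients survives: a smaller index in [f] forces one beyond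
   the degree of [f ^+ k]. *)
rewrite mulnS exprS coefM (bigD1 (inord (size f).-1)) //= inordK ?ltnS ?leq_addr //.
rewrite addKn IHk exprS lead_coefE big1 ?addr0 // => i.
rewrite -(inj_eq val_inj) /= inordK ?ltnS ?leq_addr //.
move=> ne_i; have := ltn_ord i; case: (ltnP i (size f).-1) => lei lti.
  rewrite (_ : _`_(_ - i) = 0) ?mulr0 //; apply: nth_default.
  apply: leq_trans (size_poly_exp_leq _ _) _.
  by rewrite -addnBAC ?(ltnW lei) // -add1n leq_add2r subn_gt0.
have szf : (0 < size f)%N by rewrite size_poly_gt0.
rewrite nth_default ?mul0r // -[leqLHS](prednK szf) ltn_neqAle eq_sym.
by rewrite ne_i.
Qed.

(** If [f] had degree at least 2, the product of [lead_coef f] and a power of [lead_coef g] would be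
    a nonzero coefficient of ['X] at an index above 1. *)
Lemma comp_inverse_size f g : f \Po g = 'X -> (size f <= 2)%N.
Proof.
move=> fg; rewrite leqNgt; apply/negP => szf.
set e := (size g).-1; have e_gt0 : (0 < e)%N.
  rewrite lt0n; apply/eqP => e0; have : (size g <= 1)%N by rewrite -/e; lia.
  move=> /size1_polyC gC; have := congr1 (fun p : {poly B} => size p) fg.
  rewrite gC comp_polyCr size_polyX => sz.
  by have := size_polyC_leq1 f.[g`_0]; rewrite sz.
have f0 : f != 0 by rewrite -size_poly_gt0; lia.
have g0 : g != 0 by rewrite -size_poly_gt0; lia.
have := congr1 (fun p : {poly B} => p`_(e * (size f).-1)) fg.
rewrite coef_comp_poly -(prednK (_ : 0 < size f)%N); last by lia.
rewrite big_ord_recr /= coef_exp_deg big1 => [|i _]; last first.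
  rewrite [X in _ * X]nth_default ?mulr0 //.
  by apply: leq_trans (size_poly_exp_leq _ _) _; rewrite -/e; have := ltn_ord i; nia.
rewrite add0r coefX; have -> : (e * (size f).-1 == 1)%N = false by nia.
move/domB; rewrite -lead_coefE lead_coef_eq0 (negPf f0).
by rewrite (negPf (domain_expf_neq0 _ _)) // lead_coef_eq0.
Qed.

End CompositionInverseDomain.

(** * Degrees over the quotients of [R] by powers of [q] *)

Section QuotientDegrees.

Variables (R : comNzRingType) (q : R) (q_prime : is_prime_ideal (principal q)).

Local Notation quo m_gt0 := {ideal_quot (qpow q_prime m_gt0)}.

Lemma pi_qpow n (n_gt0 : (0 < n)%N) : (\pi_(quo n_gt0) q) ^+ n = 0.
Proof.
rewrite -rmorphXn -(rmorph0 (\pi_(quo n_gt0))); apply/eqP.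
by rewrite -Quotient.idealrBE subr0; apply/asboolP; exists 1; rewrite mulr1.
Qed.

Lemma qred_eq0 m n (m_gt0 : (0 < m)%N) (n_gt0 : (0 < n)%N) (le_mn : (m <= n)%N)
    (x : quo n_gt0) :
  (qred m_gt0 le_mn x == 0) = (x \in principal ((\pi_(quo n_gt0) q) ^+ m)).
Proof.
apply/idP/idP.
  rewrite -[x]reprK qredE -(rmorph0 (\pi_(quo m_gt0))) -Quotient.idealrBE subr0.
  move=> /asboolP[y ->]; apply/asboolP; exists (\pi_(quo n_gt0) y).
  by rewrite -rmorphXn -rmorphM.
move=> /asboolP[y ->]; rewrite -[y]reprK -rmorphXn -rmorphM qredE.
rewrite -(rmorph0 (\pi_(quo m_gt0))) -Quotient.idealrBE subr0.
by apply/asboolP; exists (repr y).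
Qed.

(** Replaces degrees over varying quotients by divisibility inside the single ring [R/q^n]. *)
Lemma deg_qred_leq m n (m_gt0 : (0 < m)%N) (n_gt0 : (0 < n)%N)
    (le_mn : (m <= n)%N) (p : {poly quo n_gt0}) k :
  (deg (map_poly (qred m_gt0 le_mn) p) <= k)%N <->
  (forall j, (k < j)%N -> p`_j \in principal ((\pi_(quo n_gt0) q) ^+ m)).
Proof.
have -> : (deg (map_poly (qred m_gt0 le_mn) p) <= k)%N =
          (size (map_poly (qred m_gt0 le_mn) p) <= k.+1)%N.
  by rewrite /deg -subn1 leq_subLR.
split=> [/leq_sizeP szp j ltkj|bp].
  by rewrite -(qred_eq0 m_gt0 le_mn) -coef_map szp.
by apply/leq_sizeP => j ltkj; apply/eqP; rewrite coef_map qred_eq0 bp.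
Qed.

Lemma qpow1_domain (x y : quo (ltn0Sn 0)) : x * y = 0 -> (x == 0) || (y == 0).
Proof.
have pi_eq0 z : (\pi_(quo (ltn0Sn 0)) z == 0) = (z \in principal q).
  by rewrite -(rmorph0 (\pi_(quo (ltn0Sn 0)))) -Quotient.idealrBE subr0.
rewrite -[x]reprK -[y]reprK -rmorphM => /eqP; rewrite !pi_eq0.
by have [_ qP] := q_prime; apply: qP.
Qed.

(** Reduction modulo [q] preserves [f \Po g = 'X] and lands in a domain. This supplies level 0, on
    which [Atilde] imposes nothing. *)
Lemma comp_invertible_deg_bounded1 n (n_gt0 : (0 < n)%N) d
    (f : {poly quo n_gt0}) :
  comp_invertible f -> deg_bounded (\pi_(quo n_gt0) q) (slope d) 1 f.
Proof.
move=> /asboolP[g [fg _]] s; rewrite ltnS leqn0 => /eqP ->.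
apply/(deg_qred_leq (ltn0Sn 0) n_gt0).
have := congr1 (map_poly (qred (ltn0Sn 0) n_gt0)) fg.
rewrite map_comp_poly map_polyX => /(comp_inverse_size qpow1_domain).
by rewrite /deg -subn1 leq_subLR.
Qed.

Lemma AtildeP n d (n_ge2 : (2 <= n)%N) (psi : autA1 (quo (ltnW n_ge2))) :
  (1 <= d)%N ->
  psi \in Atilde q_prime n d n_ge2 <->
  deg_bounded (\pi_(quo (ltnW n_ge2)) q) (slope d) n (val psi).
Proof.
move=> d_ge1.
(* [d >= 1] makes the maximum with 1 harmless; level [s.+1] is the condition for [m = s.+2]. *)
have slopeE s : slope d s.+1 = (2 ^ s * d)%N.
  by rewrite /slope /=; have := expn_gt0 2 s; nia.
split=> [/asboolP psiA [|s] ltsn|bpsi].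
- exact: (comp_invertible_deg_bounded1 (valP psi)).
- have := psiA s.+2 isT ltsn; rewrite 2!subSS subn0 -slopeE.
  by move/deg_qred_leq.
apply/asboolP => -[|[|m]] // m_ge2 le_mn.
by rewrite 2!subSS subn0 -slopeE; apply/deg_qred_leq/bpsi.
Qed.

End QuotientDegrees.

Theorem theorem2p1 (R : comNzRingType) (q : R)
    (q_torsion_free : forall x : R, q * x = 0 -> x = 0)
    (q_prime : is_prime_ideal (principal q))
    (n d : nat) (n_ge2 : (2 <= n)%N) (d_ge1 : (1 <= d)%N) :
  group_closed (Atilde q_prime n d n_ge2).
Proof.
split; first by apply/AtildeP => //; apply: deg_bounded_slopeX.
move=> f g /AtildeP bf /AtildeP bg; apply/AtildeP => //.
apply: deg_bounded_comp; first exact: bf.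
apply: deg_bounded_inverse (bg d_ge1) _; first exact: pi_qpow.
  by have /(congr1 val) := mulgV g.
(* The induction for the inverse starts at level 0, where being an automorphism suffices. *)
exact/comp_invertible_deg_bounded1/(valP g^-1%g).
Qed.
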